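(* Let $X$ be a compact Hausdorff space with a free interval and let $\Phi$ be a minimal action of an abelian semigroup $S$ on $X$. Then $X$ is a disjoint union of finitely many circles and all the acting maps of $\Phi$ are homeomorphisms of $X$.
   Context: A free interval in a topological space $X$ is an open subset of $X$ homeomorphic to the open interval $(0,1)$. Semigroups are nonempty and carry the discrete topology. An action of an abelian semigroup $S$ on a space $X$ is a continuous map $\Phi\colon S\times X\to X$ with $\Phi(s,\Phi(t,x))=\Phi(s+t,x)$ for all $s,t\in S$, $x\in X$; its acting maps are $\varphi_s=\Phi(s,\cdot)\colon X\to X$, $s\in S$. The action is minimal if for every $x\in X$ the orbit $\{\varphi_s(x): s\in S\}$ is dense in $X$. ''$X$ is a disjoint union of finitely many circles'' means that $X$ is homeomorphic to the topological disjoint union of finitely many copies of the circle $\mathbb S^1$. *)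

(* Defs.v *)
From HB Require Import structures.
From mathcomp Require Import all_boot all_order all_algebra.
From mathcomp Require Import all_classical all_reals all_analysis.

Set Implicit Arguments.
Unset Strict Implicit.
Unset Printing Implicit Defensive.

Import Order.TTheory GRing.Theory Num.Theory.
Import numFieldNormedType.Exports.

Local Open Scope classical_set_scope.
Local Open Scope ring_scope.

Definition homeomorphism (X Y : topologicalType) (f : X -> Y) : Prop :=
  continuous f /\ exists g : Y -> X, [/\ continuous g, cancel f g & cancel g f].

Definition homeomorphic (X Y : topologicalType) : Prop :=
  exists f : X -> Y, homeomorphism f.

(* Subsets are compared through [set_type], which carries the topology induced
   by the inclusion; the library's [subspace] would instead retopologize the
   whole ambient type. *)
Definition free_interval (R : realType) (X : topologicalType) (U : set X) :
  Prop := open U /\ homeomorphic (set_type U) (set_type `]0 : R, 1[).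

Definition circle (R : realType) : set (R * R) :=
  [set z | z.1 ^+ 2 + z.2 ^+ 2 = 1].
Arguments circle R : clear implicits.

Definition finite_union_of_circles (R : realType) (X : topologicalType) : Prop :=
  exists n : nat, homeomorphic X {i : 'I_n & set_type (circle R)}.

(* An [addSemigroupType] is commutative. It need not have a neutral element, and
   if it has one, the neutral element need not act as the identity. *)
Definition semigroup_action (S : addSemigroupType) (X : topologicalType)
    (Phi : discrete_topology S * X -> X) : Prop :=
  continuous Phi /\
  forall (s t : S) (x : X), Phi (s, Phi (t, x)) = Phi (s + t, x).

Definition acting_map (S : addSemigroupType) (X : topologicalType)
  (Phi : discrete_topology S * X -> X) (s : S) : X -> X := fun x => Phi (s, x).

Definition minimal_action (S : addSemigroupType) (X : topologicalType)
    (Phi : discrete_topology S * X -> X) : Prop :=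
  forall x : X, dense [set acting_map Phi s x | s in [set: S]].

(* Main.v *)
(* Compare an acting map with two others near a point y of a free interval J:
   by minimality some maps move y slightly to the right and some slightly to the
   left, and by commutativity two acting maps that agree somewhere are equal. So
   the graph of an acting map that is between those two at one point near y stays
   between them throughout a neighbourhood of y. Since finitely many images of J
   cover X, it follows that phi_s(x) tends to x for every x as soon as phi_s(p)
   tends to p for one p. As the orbit of phi_r(p) comes back to p, every phi_r has
   approximate left inverses, hence is injective, hence a homeomorphism.

   Now let g be an acting map which moves p to the right inside J by so little
   that A = [p, g p] and g A are adjacent arcs of J. The arcs A, g A, g^2 A, ...
   make up a half-line in X, and compactness together with minimality forces it to
   meet A again; since g is injective, the first return to A happens at p, which
   gives an embedded circle. An embedded circle is open, because X is a
   one-dimensional manifold, and the preimages of this circle under finitely many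
   phi_s cover X. *)

Require Import Defs.
From HB Require Import structures.
From mathcomp Require Import all_boot all_order all_algebra.
From mathcomp Require Import all_classical all_reals all_analysis.
From mathcomp Require Import lra ring.

Import Order.TTheory GRing.Theory Num.Theory.
Import numFieldNormedType.Exports.
Local Open Scope classical_set_scope.
Local Open Scope ring_scope.
Set Implicit Arguments.
Unset Strict Implicit.
Unset Printing Implicit Defensive.

(** * Intermediate values, connectedness and compactness *)

Lemma image_IVT (R : realType) (f : R -> R) (a b v : R) : a <= b ->
  (forall t, a <= t <= b -> {for t, continuous f}) ->
  f a <= v <= f b \/ f b <= v <= f a -> exists2 t, a <= t <= b & f t = v.
Proof.
move=> ab cf fv; have cw : {within `[a, b], continuous f}.
  by apply: continuous_in_subspaceT => t /set_mem; rewrite /= in_itv /=;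
    exact: cf.
have [|t] := IVT (v := v) ab cw; last by rewrite in_itv /= => ? <-; exists t.
by case: fv => /andP[fv1 fv2]; rewrite ge_min le_max fv1 fv2 ?orbT.
Qed.

(** The points where [P] holds and those where it fails are both relatively open, so connectedness
    of the interval leaves only one kind. *)
Lemma interval_locally_constant (R : realType) (P : set R) (a b t u : R) :
  (forall x, a < x < b -> \forall y \near x, P y <-> P x) ->
  a < t < b -> a < u < b -> P t -> P u.
Proof.
move=> loc tab uab Pt.
pose I : set R := `]a, b[%classic.
have II x : I x = (a < x < b) :> Prop by rewrite /I /= in_itv.
have cI : connected I by apply/connected_intervalP; exact: interval_is_interval.
pose O (Q : set R) := interior (fun x => I x -> Q x).
have OQ Q x : O Q x -> I x -> Q x by move=> /nbhs_singleton.
have oP x : I x -> P x -> O P x.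
  move=> Ix Px; move: (Ix); rewrite II => /loc.
  by apply: filterS => y yP _; apply/yP.
have onP x : I x -> ~ P x -> O (~` P) x.
  move=> Ix Px; move: (Ix); rewrite II => /loc.
  by apply: filterS => y yP _ /yP.
suff E : I `&` P = I by have : (I `&` P) u; [rewrite E II|case].
apply: cI; first by exists t; rewrite /setI /= II.
- exists (O P); first exact: open_interior.
  by apply/seteqP; split=> x [Ix Px]; split=> //; [exact: oP|exact: OQ Px _].
- exists (~` O (~` P)); first by apply: open_closedC; exact: open_interior.
  apply/seteqP; split=> x [Ix Px]; split=> //; first by move=> /OQ; exact.
  by apply: contrapT => /(onP _ Ix).
Qed.

(** Invariance of domain on the line: injectivity and intermediate values put [f t] strictly between
    the values at a point on its left and one on its right. *)
Lemma continuous_inj_image_nbhs (R : realType) (f : R -> R) (a b t : R) :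
  a < t < b -> (forall x, a < x < b -> {for x, continuous f}) ->
  (forall x y, a < x < b -> a < y < b -> f x = f y -> x = y) ->
  nbhs (f t) (f @` [set x | a < x < b]).
Proof.
move=> /andP[at_ tb] cf injf.
pose l := (a + t) / 2; pose r := (t + b) / 2.
have [al lt] : a < l /\ l < t by rewrite /l; split; lra.
have [tr rb] : t < r /\ r < b by rewrite /r; split; lra.
have hit x y v : l <= x -> x <= y -> y <= r ->
    f x <= v <= f y \/ f y <= v <= f x -> exists2 z, x <= z <= y & f z = v.
  move=> lx xy yr; apply: image_IVT => // z /andP[xz zy]; apply: cf.
  by apply/andP; split; lra.
have flt : f l != f t by apply/eqP => /injf; lra.
have frt : f r != f t by apply/eqP => /injf; lra.
have flr : f l != f r by apply/eqP => /injf; lra.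
(* If [f t] were extremal among the three values, the end value nearer to it would be taken again on
   the other side of [t]. *)
have mono : f l < f t < f r \/ f r < f t < f l.
  have [] := ltgtP (f l) (f t) => [flt1|flt1|/eqP]; last by rewrite (negPf flt).
  - have [] := ltgtP (f t) (f r) => [|frt1|/esym/eqP];
    last by rewrite (negPf frt).
      by left.
    have [] := ltgtP (f l) (f r) => [flr1|flr1|/eqP];
      last by rewrite (negPf flr).
      have [||||z zlt fz] := hit l t (f r); [lra|lra|lra|left; lra|].
      by have := injf z r; lra.
    have [||||z zlt fz] := hit t r (f l); [lra|lra|lra|right; lra|].
    by have := injf z l; lra.
  - have [] := ltgtP (f t) (f r) => [frt1||/esym/eqP];
    last by rewrite (negPf frt).
      have [] := ltgtP (f l) (f r) => [flr1|flr1|/eqP];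
        last by rewrite (negPf flr).
        have [||||z zlt fz] := hit t r (f l); [lra|lra|lra|left; lra|].
        by have := injf z l; lra.
      have [||||z zlt fz] := hit l t (f r); [lra|lra|lra|right; lra|].
      by have := injf z r; lra.
    by right.
have sub v : f l <= v <= f r \/ f r <= v <= f l ->
    (f @` [set x | a < x < b]) v.
  move=> /(hit l r v (lexx _) (ltW (lt_trans lt tr)) (lexx _))[z zlr fz].
  by exists z => //=; apply/andP; split; lra.
case: mono => /andP[m1 m2].
  near=> v; apply: sub; left; apply/andP; split; apply: ltW; near: v.
    exact: lt_nbhsr.
  exact: lt_nbhsl.
near=> v; apply: sub; right; apply/andP; split; apply: ltW; near: v.
  exact: lt_nbhsr.
exact: lt_nbhsl.
Unshelve. all: by end_near.
Qed.

Lemma compact_bij_homeomorphism (X Y : topologicalType) (f : X -> Y) :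
  compact [set: X] -> hausdorff_space Y -> continuous f ->
  injective f -> (forall y, exists x, f x = y) -> homeomorphism f.
Proof.
move=> cX hY cf injf surjf; split=> //.
pose g y := projT1 (cid (surjf y)).
have fK : cancel g f by move=> y; rewrite /g; case: cid.
have gK : cancel f g by move=> x; apply: injf; rewrite fK.
exists g; split=> //; apply/continuous_closedP => F cF.
have -> : g @^-1` F = f @` F.
  apply/seteqP; split=> [y Fy|_ [x Fx <-]]; last by rewrite /= gK.
  by exists (g y).
apply: compact_closed => //; apply: continuous_compact.
  exact: continuous_subspaceT.
by rewrite -[F]setTI; apply: compact_closedI.
Qed.

Lemma compact_seq_cover (X : topologicalType) (I : eqType) (f : I -> set X) :
  compact [set: X] -> (forall i, open (f i)) -> (forall x, exists i, f i x) ->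
  exists l : seq I, forall x, exists2 i, i \in l & f i x.
Proof.
move=> /compact_near_coveringP cX of_ covf.
(* Finite lists are directed by inclusion. The near-covering form of compactness, applied to the
   tail filter [F], gives one list that serves all points. *)
pose F : set_system (seq I) :=
  [set A | exists l : seq I, forall l' : seq I, {subset l <= l'} -> A l'].
have FF : Filter F.
  split; first by exists [::].
  - move=> A B [l lA] [l' lB]; exists (l ++ l') => m lm; split.
      by apply: lA => i il; apply: lm; rewrite mem_cat il.
    by apply: lB => i il; apply: lm; rewrite mem_cat il orbT.
  - by move=> A B AB [l lA]; exists l => m /lA /AB.
have [x _|l lP] := cX _ F (fun l x => exists2 i, i \in l & f i x) FF.
  have [i fix_] := covf x.
  exists (f i, [set l : seq I | i \in l]) => /=; last by move=> [y l] [/=];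
    exists i.
  split; first exact: open_nbhs_nbhs.
  by exists [:: i] => l; apply; rewrite inE.
by exists l => x; exact: lP.
Qed.

(** * Charts of free intervals *)

Section FreeInterval.
Context (R : realType) (X : topologicalType).

(** Both [e] and [k] are total, with arbitrary values off []0, 1[] and [U], so that coordinates are
    plain reals. *)
Record chart (U : set X) (e : R -> X) (k : X -> R) : Prop := Chart {
  chart_open : open U;
  chart_mem : forall t, 0 < t < 1 -> U (e t);
  chart_itv : forall x, U x -> 0 < k x < 1;
  chartK : forall x, U x -> e (k x) = x;
  chartVK : forall t, 0 < t < 1 -> k (e t) = t;
  chart_continuous : forall t, 0 < t < 1 -> {for t, continuous e};
  chartV_continuous : forall x, U x -> {for x, continuous k} }.

Lemma free_interval_chart (U : set X) :
  free_interval R U -> exists e k, chart U e k.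
Proof.
move=> [oU [f [cf [g [cg fK gK]]]]].
have hU : exists x, U x.
  have h : 0 < (2^-1 : R) < 1 by rewrite invr_gt0 invf_lt1 ?ltr0n ?ltr1n.
  have hI : 2^-1 \in (`]0, 1[%classic : set R) by apply/mem_set;
    rewrite /= in_itv.
  by exists (set_val (g (SigSub hI))); exact: set_valP.
have [x0 Ux0] := hU.
pose e (t : R) : X := if pselect (`]0, 1[%classic t) is left h
  then set_val (g (SigSub (mem_set h))) else x0.
pose k (x : X) : R := if pselect (U x) is left h
  then set_val (f (SigSub (mem_set h))) else 0.
exists e, k.
have eE t (h : t \in (`]0, 1[%classic : set R)) : e t = set_val (g (SigSub h)).
  rewrite /e; case: pselect => [h'|]; last by have /set_mem := h.
  by congr (set_val (g _)); apply: val_inj.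
have kE x (h : x \in U) : k x = set_val (f (SigSub h)).
  rewrite /k; case: pselect => [h'|]; last by have /set_mem := h.
  by congr (set_val (f _)); apply: val_inj.
have memI t : 0 < t < 1 -> t \in (`]0, 1[%classic : set R).
  by move=> h; apply/mem_set; rewrite /= in_itv.
have ce : {within `]0, 1[, continuous e}.
  apply/subspace_sigL_continuousP; have -> : sigL `]0, 1[ e = set_val \o g.
    apply/funext => -[t ht] /=; rewrite /sigL /= (eE _ ht).
    by congr (set_val (g _)); apply: val_inj.
  by move=> y; apply: continuous_comp; [exact: cg|exact: initial_continuous].
have ck : {within U, continuous k}.
  apply/subspace_sigL_continuousP; have -> : sigL U k = set_val \o f.
    apply/funext => -[x hx] /=; rewrite /sigL /= (kE _ hx).
    by congr (set_val (f _)); apply: val_inj.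
  by move=> y; apply: continuous_comp; [exact: cf|exact: initial_continuous].
rewrite !continuous_open_subspace // in ce ck.
split=> //.
- by move=> t /memI h; rewrite (eE _ h); exact: set_valP.
- move=> x /mem_set h; rewrite (kE _ h).
  by have := set_valP (f (SigSub h)); rewrite /= in_itv.
- move=> x /mem_set h; rewrite (kE _ h).
  have h' : set_val (f (SigSub h)) \in (`]0, 1[%classic : set R).
    by apply/mem_set; exact: set_valP.
  rewrite (eE _ h'); have -> : SigSub h' = f (SigSub h) by apply: val_inj.
  by rewrite fK.
- move=> t /memI h; rewrite (eE _ h).
  have h' : set_val (g (SigSub h)) \in U by apply/mem_set; exact: set_valP.
  rewrite (kE _ h'); have -> : SigSub h' = g (SigSub h) by apply: val_inj.
  by rewrite gK.
- by move=> t /memI; exact: ce.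
- by move=> x /mem_set; exact: ck.
Qed.
End FreeInterval.

(** * The loop closed by the first return to an arc *)

Section FirstReturn.
Context (R : realType) (X : topologicalType) (g : X -> X) (arc : R -> X).
Hypotheses (g_continuous : continuous g) (g_inj : injective g).
Hypothesis arc_continuous : continuous arc.
Hypothesis arc_inj :
  forall t u : R, 0 <= t <= 1 -> 0 <= u <= 1 -> arc t = arc u -> t = u.
Hypothesis arc1 : arc 1 = g (arc 0).
Let A := arc @` [set t : R | 0 <= t <= 1].
Hypothesis closedA : closed A.
Hypothesis nbhsA : forall t : R, 0 < t < 1 -> nbhs (arc t) A.
Hypothesis g_arc : forall t : R, 0 < t <= 1 -> ~ A (g (arc t)).
Hypothesis return_arc :
  exists (t : R) n, [/\ 0 <= t <= 1, (2 <= n)%N & A (iter n g (arc t))].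

(* [truncn] is 0 on negative reals, so with [Num.max] the function is constant
   there, and continuous on the whole line. *)
Definition flow_line (t : R) : X :=
  iter (Num.truncn t) g (arc (Num.max 0 (t - (Num.truncn t)%:R))).
Let psi := flow_line.

Lemma flow_line_arc t : 0 <= t < 1 -> psi t = arc t.
Proof.
move=> t01; rewrite /psi /flow_line (@truncn_def _ t 0%N) ?mulr0n // subr0 /=.
by rewrite max_r //; case/andP: t01.
Qed.

Lemma flow_lineS t : 0 <= t -> psi (t + 1) = g (psi t).
Proof.
move=> t0; have /andP[h1 h2] := truncn_itv t0.
rewrite /psi /flow_line (@truncn_def _ (t + 1) (Num.truncn t).+1) /=;
  last first.
  by rewrite -!natr1 in h2 *; apply/andP; split; lra.
by congr (g (iter _ g (arc (Num.max 0 _)))); rewrite -natr1; ring.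
Qed.

Lemma flow_lineD n t : 0 <= t -> psi (t + n%:R) = iter n g (psi t).
Proof.
move=> t0; elim: n => [|n IH]; first by rewrite mulr0n addr0.
by rewrite -natr1 addrA flow_lineS ?IH //; apply: addr_ge0.
Qed.

Lemma flow_line_arc1 t : 0 <= t <= 1 -> psi t = arc t.
Proof.
move=> t01; have [t1|t1] := ltP t 1; first by apply: flow_line_arc; lra.
have -> : t = 0 + 1 by lra.
by rewrite flow_lineS // flow_line_arc ?add0r //; lra.
Qed.

(** Induction on an integer bound for [t]: before time 1 [psi] is the arc, and from then on it is
    [g] applied with unit delay. The two formulas fit together at time 1 by [arc1]. *)
Lemma flow_line_continuous : continuous psi.
Proof.
have psi1 u : u < 1 -> psi u = arc (Num.max 0 u).
  rewrite -(truncn_le_nat u 0) leqn0 => /eqP u0.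
  by rewrite /psi /flow_line u0 mulr0n subr0.
have psiB u : 1 <= u -> psi u = g (psi (u - 1)).
  by move=> u1; rewrite -flow_lineS ?subrK // subr_ge0.
have c0 (t : R) (V : set X) : nbhs (arc (Num.max 0 t)) V ->
    \forall u \near t, V (arc (Num.max 0 (u : R))).
  have c : {for t, continuous (fun u : R => arc (Num.max 0 u))}.
    apply: (@continuous_comp _ _ _ (fun u : R => Num.max 0 u)).
      by apply: continuous_max; [exact: cvg_cst|exact: cvg_id].
    exact: arc_continuous.
  exact: c.
have cS (t : R) (V : set X) :
  {for t - 1, continuous psi} -> nbhs (g (psi (t - 1))) V ->
    \forall u \near t, V (g (psi ((u : R) - 1))).
  move=> ct; have cB : {for t, continuous (fun u : R => u - 1)}.
    by apply: continuousB; [exact: cvg_id|exact: cvg_cst].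
  have c : {for t, continuous (fun u : R => g (psi (u - 1)))}.
    apply: (@continuous_comp _ _ _ _ (g \o psi) t cB).
    by apply: continuous_comp; [exact: ct|exact: g_continuous].
  exact: c.
suff cn n t : t < n.+1%:R -> {for t, continuous psi}.
  by move=> t; apply: (cn (Num.truncn t)); exact: truncnS_gt.
elim: n t => [|n IH] t tn V Vt.
  rewrite psi1 // in Vt.
  apply: filterS2 (lt_nbhsl tn) (c0 _ _ Vt) => u u1 Vu.
  by rewrite /= psi1.
have [t1|t1] := ltP t 1.
  rewrite psi1 // in Vt.
  apply: filterS2 (lt_nbhsl t1) (c0 _ _ Vt) => u u1 Vu.
  by rewrite /= psi1.
rewrite -natr1 -ltrBlDr in tn.
have VS : \forall u \near t, V (g (psi ((u : R) - 1))).
  by apply: cS; [exact: IH|rewrite -psiB].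
have [t1'|t1'] := ltP 1 t.
  apply: filterS2 (lt_nbhsr t1') VS => u u1 Vu.
  by rewrite /= psiB // ltW.
have t1E : t = 1 by lra.
have V0 : \forall u \near t, V (arc (Num.max 0 (u : R))).
  apply: c0; move: Vt; rewrite t1E flow_line_arc1 ?max_r //; lra.
apply: filterS2 VS V0 => u Vu1 Vu0 /=.
by have [u1|u1] := ltP u 1; [rewrite psi1|rewrite psiB].
Qed.

(** [tau] is the least time at which the half-line is on the arc again. It comes from outside [A],
    so it cannot arrive at an interior point of the arc, and arriving at [arc 1] would give an
    earlier return; only [arc 0] remains. *)
Lemma first_return : exists2 tau : R, 0 < tau & [/\ psi tau = psi 0 &
  forall a b, 0 <= a -> a < b -> b < tau -> psi a <> psi b].
Proof.
have A_arc t : 0 <= t <= 1 -> A (psi t).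
  by move=> t01; exists t => //; rewrite flow_line_arc1.
have notA12 t : 1 < t <= 2 -> ~ A (psi t).
  move=> t12; have -> : t = (t - 1) + 1 by lra.
  rewrite flow_lineS ?flow_line_arc1; [|lra|lra].
  by apply: g_arc; lra.
(* Times in []1, 2]] are excluded by [g_arc]; searching from 2 on gives a closed set of times, which
   has a least element. *)
pose T := [set t | 2 <= t /\ A (psi t)].
have [t0 [n [t01 n2 At0]]] := return_arc.
have Tt0 : T (t0 + n%:R).
  split; last by rewrite flow_lineD ?flow_line_arc1 //; case/andP: t01.
  by have : (2 : R) <= n%:R by [rewrite ler_nat]; lra.
have [tau [tau2 Atau] tauP] : exists2 tau, T tau & forall t, T t -> tau <= t.
  pose B := `[2, t0 + n%:R]%classic `&` psi @^-1` A.
  have cB : compact B.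
    apply: compact_closedI; first exact: segment_compact.
    by apply: closed_comp => // t _; exact: flow_line_continuous.
  have B0 : B !=set0.
    exists (t0 + n%:R); case: Tt0 => *; split=> //=.
    by rewrite in_itv /= lexx andbT.
  have [//|tau] := @compact_EVT_min R R id B B0 cB.
    by apply: continuous_subspaceT => t; exact: cvg_id.
  rewrite inE => -[/=]; rewrite in_itv /= => /andP[tau2 taut0] Atau tauP.
  exists tau => // t [t2 At]; have [tt0|tt0] := leP t (t0 + n%:R); last lra.
  by apply: tauP; rewrite inE; split=> //=; rewrite in_itv /= t2.
have notA t : 1 < t < tau -> ~ A (psi t).
  move=> t1; have [t2|t2] := leP t 2; first by apply: notA12; lra.
  by move=> At; have : tau <= t by [apply: tauP; split=> //; lra]; lra.
exists tau; first lra.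
split.
  have tau2' : 2 < tau.
    rewrite lt_neqAle tau2 andbT; apply/eqP => E.
    by apply: (notA12 2); [lra|rewrite E].
  have [y /andP[y0 y1] yE] := Atau.
  have [y0E|yn0] := eqVneq y 0;
    first by rewrite -yE y0E flow_line_arc1 ?lexx ?ler01.
  have {yn0}y0 : 0 < y by rewrite lt_neqAle eq_sym yn0.
  have [y1E|yn1] := eqVneq y 1.
    (* By injectivity of [g], the orbit would already be on the arc at time
       [tau - 1]. *)
    have : g (psi (tau - 1)) = g (psi 0).
      rewrite -flow_lineS ?subrK; last lra.
      by rewrite -yE y1E arc1 flow_line_arc1 ?lexx ?ler01.
    move=> /g_inj E; have : A (psi (tau - 1)) by rewrite E; apply: A_arc; lra.
    by move=> /notA; case; lra.
  have {yn1}y1 : y < 1 by rewrite lt_neqAle yn1.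
  have Nt : nbhs (psi tau) A by rewrite -yE; apply: nbhsA; rewrite y0.
  have /nbhs_ballP[r /= r0 rA] := flow_line_continuous Nt.
  pose u := Num.max 2 (tau - r / 2).
  have [u2 ur ut] : [/\ 2 <= u, tau - r / 2 <= u & u < tau].
    by rewrite /u !le_max !lexx orbT gt_max tau2'; split=> //; lra.
  exfalso; apply: (notA u); first lra.
  by apply: rA; rewrite /ball /= ltr_norml; lra.
move=> a b a0 ab btau abE.
(* Injectivity of [g] allows both times to be shifted back by the integer part of [a]. The first
   point is then on the arc, hence so is the second, which forces its time to be at most 1, where
   [arc] is injective. *)
have /andP[na an] := truncn_itv a0; set m := Num.truncn a in na an.
have /flow_line_arc1 E1 : 0 <= a - m%:R <= 1 by rewrite -natr1 in an; lra.
have E : psi (a - m%:R) = psi (b - m%:R).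
  have iter_inj j : injective (iter j g) by elim: j => //= j IH x y /g_inj/IH.
  apply: (iter_inj m); rewrite -!flow_lineD ?subrK //; lra.
rewrite -natr1 in an.
have Ab : A (psi (b - m%:R)) by rewrite -E; apply: A_arc; lra.
have [b1|b1] := ltP 1 (b - m%:R).
  by apply: notA Ab; have := ler0n R m; lra.
rewrite flow_line_arc1 in E; last lra.
rewrite flow_line_arc1 in E; last lra.
by have := arc_inj _ _ E; lra.
Qed.
End FirstReturn.

(** * Circles *)

Section Circle.
Context (R : realType).
Local Notation circ := (set_type (circle R)).

Lemma cos_sin_circle (t : R) : (cos t, sin t) \in circle R.
Proof. by apply/mem_set; rewrite /circle /= cos2Dsin2. Qed.

Definition circle_point (t : R) : circ := SigSub (cos_sin_circle t).

Lemma cos_sin_continuous : continuous (fun t : R => (cos t, sin t)).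
Proof.
by move=> t; exact: (cvg_pair (@continuous_cos R t) (@continuous_sin R t)).
Qed.

Lemma circle_point_continuous : continuous circle_point.
Proof. by apply/continuous_comp_initial => t; exact: cos_sin_continuous. Qed.

Lemma circle_point_surj (z : circ) :
  exists2 t, 0 <= t < pi *+ 2 & circle_point t = z.
Proof.
case: z => -[x y] xyC; have /= xy1 := set_mem xyC.
have x1 : -1 <= x <= 1 by rewrite /circle /= in xy1; apply/andP; split; nra.
have pi0 := pi_gt0 R; have a0 := acos_ge0 x1; have api := acos_lepi x1.
have cosa : cos (acos x) = x by apply: acosK; rewrite in_itv.
have sina : sin (acos x) = `|y|.
  by rewrite sin_acos // -xy1 addrAC subrr add0r sqrtr_sqr.
have [y0|y0] := leP 0 y.
  exists (acos x); first by rewrite mulr2n; lra.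
  by apply: val_inj; rewrite /= cosa sina ger0_norm.
have an0 : acos x != 0.
  apply/eqP => E; move: sina; rewrite E sin0 => /esym/eqP.
  by rewrite normr_eq0 lt_eqF.
have {}a0 : 0 < acos x by rewrite lt_neqAle eq_sym an0.
exists (pi *+ 2 - acos x); first by rewrite mulr2n; lra.
apply: val_inj; rewrite /= cosB sinB cos2pi sin2pi cosa sina ltr0_norm //.
by congr (_, _); ring.
Qed.

Lemma circle_point_inj (a b : R) :
  `|a - b| < pi *+ 2 -> circle_point a = circle_point b -> a = b.
Proof.
rewrite mulr2n ltr_norml => /andP[ab1 ab2] /(congr1 set_val)/= [cab sab].
pose h := (a - b) / 2.
have sinh : sin h = 0.
  have cos1 : cos (h + h) = 1.
    have -> : h + h = a - b by rewrite /h; field.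
    by rewrite cosB cab sab -!expr2 cos2Dsin2.
  have := cos2Dsin2 h; rewrite cosD in cos1; nra.
have [h0|h0|h0] := ltgtP h 0; last by rewrite /h in h0; lra.
- have : 0 < sin (- h) by apply: sin_gt0_pi; rewrite /h in h0 *; lra.
  by rewrite sinN sinh oppr0 ltxx.
- have : 0 < sin h by apply: sin_gt0_pi; rewrite /h in h0 *; lra.
  by rewrite sinh ltxx.
Qed.

Lemma circle_point2pi : circle_point (pi *+ 2) = circle_point 0.
Proof. by apply: val_inj; rewrite /= cos2pi sin2pi cos0 sin0. Qed.

Lemma circle_compact : compact [set: circ].
Proof.
have -> : [set: circ] = circle_point @` `[0, pi *+ 2].
  apply/seteqP; split=> // z _; have [t t2 <-] := circle_point_surj z.
  by exists t => //=; rewrite in_itv /=; lra.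
apply: continuous_compact; last exact: segment_compact.
by apply: continuous_subspaceT; exact: circle_point_continuous.
Qed.

(** The circle is [[0, 2 pi]] with its ends glued, and [psi], run at speed [c], respects the
    gluing. *)
Lemma loop_circle (X : topologicalType) (psi : R -> X) (tau : R) :
  continuous psi -> 0 < tau -> psi tau = psi 0 ->
  (forall a b, 0 <= a -> a < b -> b < tau -> psi a <> psi b) ->
  exists f : circ -> X, continuous f /\ injective f.
Proof.
move=> cpsi tau0 psi_tau psi_inj.
have pi2 : 0 < pi *+ 2 :> R by rewrite mulrn_wgt0 // pi_gt0.
pose c := tau / (pi *+ 2); have c0 : 0 < c by exact: divr_gt0.
pose theta (z : circ) := projT1 (cid2 (circle_point_surj z)).
have theta_itv z : 0 <= theta z < pi *+ 2 by rewrite /theta; case: cid2.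
have thetaK z : circle_point (theta z) = z by rewrite /theta; case: cid2.
pose f z := psi (c * theta z).
have cpi : c * (pi *+ 2) = tau by rewrite /c divfK // gt_eqF.
have fE t : 0 <= t <= pi *+ 2 -> f (circle_point t) = psi (c * t).
  move=> /andP[t0 t2]; have := theta_itv (circle_point t).
  have := thetaK (circle_point t); rewrite /f.
  have [t2'|t2'] := ltP t (pi *+ 2) => thK thI.
    by congr (psi (c * _)); apply: circle_point_inj thK; rewrite ltr_norml; lra.
  have tE : t = pi *+ 2 by lra.
  rewrite tE circle_point2pi in thK thI *.
  have -> : theta (circle_point 0) = 0.
    by apply: circle_point_inj thK; rewrite ltr_norml; lra.
  by rewrite mulr0 cpi psi_tau.
exists f; split.
  apply/continuous_closedP => F cF.
  (* The angle [theta] jumps at 0, so continuity is checked on closed sets: the preimage of [F] is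
     the trace of [K], a continuous image of a compact set of angles. *)
  pose K := (fun t : R => (cos t, sin t)) @`
    (`[0, pi *+ 2]%classic `&` (fun t => psi (c * t)) @^-1` F).
  have cK : closed K.
    apply: compact_closed; first exact: norm_hausdorff.
    apply: continuous_compact.
      by apply: continuous_subspaceT; exact: cos_sin_continuous.
    apply: compact_closedI; first exact: segment_compact.
    apply: closed_comp => // t _.
    apply: (@continuous_comp _ _ _ (fun t => c * t)); last exact: cpsi.
    exact: mulrl_continuous.
  have -> : f @^-1` F = set_val @^-1` K.
    apply/seteqP; split=> z.
      move=> Fz; exists (theta z); last by rewrite -[in RHS](thetaK z).
      by have := theta_itv z; split=> //=; rewrite in_itv /=; lra.
    move=> [t [/=]]; rewrite in_itv /= => t2 Ft tz.
    have -> : z = circle_point t by apply: val_inj.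
    by rewrite fE.
  by apply: closed_comp => // z _; exact: initial_continuous.
move=> z w fzw; rewrite -(thetaK z) -(thetaK w); congr circle_point.
have lt_tau z' : c * theta z' < tau.
  by rewrite -cpi ltr_pM2l //; case/andP: (theta_itv z').
have ge0 z' : 0 <= c * theta z'.
  by have /andP[h _] := theta_itv z'; exact: mulr_ge0 (ltW c0) h.
have [zw|zw|//] := ltgtP (theta z) (theta w); rewrite -(ltr_pM2l c0) in zw.
  by case: (psi_inj _ _ (ge0 z) zw (lt_tau w)).
by case: (psi_inj _ _ (ge0 w) zw (lt_tau z)).
Qed.

Lemma circle_image_clopen (X : topologicalType) (f : circ -> X) (C :
  set X) z w :
  continuous f -> open C -> closed C -> C (f z) -> C (f w).
Proof.
move=> cf oC cC.
have [t t2 <-] := circle_point_surj z; have [u u2 <-] := circle_point_surj w.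
have cfp : continuous (f \o circle_point).
  by move=> v; apply: continuous_comp;
    [exact: circle_point_continuous|exact: cf].
have p0 := pi_gt0 R; rewrite mulr2n in t2 u2.
(* The left end -1 serves only to make the angle 0 an interior point. *)
have := @interval_locally_constant R (fun v =>
  C (f (circle_point v))) (-1) (pi + pi) t u.
apply; [|lra|lra] => x _; have [Cx|nCx] := pselect (C (f (circle_point x))).
  have NC : nbhs (f (circle_point x)) C by exact: open_nbhs_nbhs.
  by have h : nbhs x ((f \o circle_point) @^-1` C) := cfp x _ NC;
    apply: filterS h => y Cy.
have NC : nbhs (f (circle_point x)) (~` C).
  by apply: open_nbhs_nbhs; split => //; exact: closed_openC.
by have h : nbhs x ((f \o circle_point) @^-1` (~` C)) := cfp x _ NC;
  apply: filterS h => y Cy; split.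
Qed.

(** Each image is open, compact and connected, so one that meets another is contained in it.
    Discarding those that meet one already kept leaves disjoint circles. *)
Lemma sum_of_circles (X : topologicalType) (x0 : X) (l : seq (circ -> X)) :
  hausdorff_space X ->
  (forall f, List.In f l -> [/\ continuous f, injective f & open (range f)]) ->
  (forall x, exists2 f, List.In f l & range f x) ->
  finite_union_of_circles R X.
Proof.
move=> hX lP lcov.
have [n [F [Fgood Fdisj Fcov]]] : exists n (F : nat -> circ -> X),
    [/\ forall i, (i < n)%N -> [/\ continuous (F i), injective (F i) & open
      (range (F i))],
    forall i j z w, (i < n)%N -> (j < n)%N -> F i z = F j w -> i = j &
    forall f z, List.In f l -> exists2 i, (i < n)%N & range (F i) (f z)].
  elim: l lP {lcov} => [|f l IH] lP; first by exists 0%N, (fun _ _ => x0);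
    split.
  have [|n [F [Fgood Fdisj Fcov]]] := IH; first by move=> h hl; apply: lP;
    right.
  have [cf injf of_] := lP f (or_introl erefl).
  have [[i [w [z [i_n Ff]]]]|nmeet] :=
    pselect (exists i w z, (i < n)%N /\ F i w = f z).
    exists n, F; split=> // h u [<-|]; last exact: Fcov.
    have [cF _ oF] := Fgood i i_n; exists i => //.
    apply: (@circle_image_clopen _ f _ z) => //; last by exists w.
    apply: compact_closed => //; apply: continuous_compact circle_compact.
    exact: continuous_subspaceT.
  exists n.+1, (fun i => if (i < n)%N then F i else f); split.
  - by move=> i _; case: ifP => [/Fgood|].
  - move=> i j w z; rewrite !ltnS => i_n j_n.
    case: ifP => [i_n'|/negbT]; case: ifP => [j_n'|/negbT].
    + exact: Fdisj.
    + by move=> _ E; case: nmeet; exists i, w, z.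
    + by move=> _ E; case: nmeet; exists j, z, w.
    + by rewrite -!leqNgt => nj ni _; apply/eqP;
      rewrite eqn_leq !(leq_trans _ ni, leq_trans _ nj).
  - move=> h u [<-|hl]; first by exists n; rewrite ?ltnn //; exists u.
    have [i i_n Fi] := Fcov h u hl; exists i; first exact: ltnW.
    by rewrite i_n.
have Fsurj x : exists i z, (i < n)%N /\ F i z = x.
  have [f fl [z _ <-]] := lcov x; have [i i_n [w _ wE]] := Fcov f z fl.
  by exists i, w.
pose H (iz : {i : 'I_n & circ}) := F (projT1 iz) (projT2 iz).
have [cH [g [cg Hg gH]]] : homeomorphism H.
  apply: compact_bij_homeomorphism => //.
  - by apply: sigT_compact; [exact: finite_finset|move=> i;
    exact: circle_compact].
  - have := @sigT_continuous _ _ _ (fun i : 'I_n => F i); apply => i.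
    by have [] := Fgood i (ltn_ord i).
  - move=> [i z] [j w]; rewrite /H /= => E.
    have ij : i = j by apply: val_inj; apply: Fdisj E.
    subst j; congr existT.
    by have [_ inj _] := Fgood i (ltn_ord i); exact: inj.
  - by move=> x; have [i [z [i_n <-]]] := Fsurj x;
    exists (existT _ (Ordinal i_n) z).
by exists n, g; split=> //; exists H.
Qed.
End Circle.

(** * Minimal actions *)

Section MinimalAction.
Context (R : realType) (X : topologicalType) (S : addSemigroupType).
Context (phi : S -> X -> X).
Hypotheses (cX : compact [set: X]) (hX : hausdorff_space X).
Hypothesis phi_continuous : forall s, continuous (phi s).
Hypothesis phiD : forall s t x, phi s (phi t x) = phi (s + t) x.
Hypothesis phi_dense : forall (x y : X) (V :
  set X), nbhs y V -> exists s, V (phi s x).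

Lemma phiC s t x : phi s (phi t x) = phi t (phi s x).
Proof. by rewrite !phiD Algebra.addrC. Qed.

Lemma nbhs_phi s x (V : set X) : nbhs (phi s x) V -> nbhs x (phi s @^-1` V).
Proof. exact: phi_continuous. Qed.

Lemma eq_orbit_eq (f g : X -> X) : continuous f -> continuous g ->
  forall x, (forall s, f (phi s x) = g (phi s x)) -> f = g.
Proof.
move=> cf cg x fg; apply/funext => y; apply: hX => A B.
move=> fA gB; have VAB : nbhs y (f @^-1` A `&` g @^-1` B).
  by apply: filterI; [exact: cf|exact: cg].
have [s [As Bs]] := phi_dense x VAB.
by exists (f (phi s x)); split=> //; rewrite fg.
Qed.

(** By commutativity the equality at [x] spreads to the orbit of [x], which is dense. *)
Lemma phi_eq s t x : phi s x = phi t x -> phi s = phi t.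
Proof.
move=> st; apply: (@eq_orbit_eq _ _ _ _ x) => // u.
by rewrite phiC st phiC.
Qed.

Lemma phi_fixed s x : phi s x = x -> phi s = id.
Proof.
move=> sx; apply: (@eq_orbit_eq _ _ _ _ x) => // [y|u]; first exact: cvg_id.
by rewrite phiC sx.
Qed.

(** The image is closed by compactness, and by commutativity it contains the dense orbit of
    [phi s y]. *)
Lemma phi_surj s y : exists x, phi s x = y.
Proof.
suff : (phi s @` setT) y by move=> [x _ <-]; exists x.
have cl : closed (phi s @` setT).
  apply: compact_closed => //; apply: continuous_compact => //.
  exact: continuous_subspaceT.
apply: cl => V yV; have [t Vt] := phi_dense (phi s y) yV.
by exists (phi t (phi s y)); split=> //; exists (phi t y) => //; rewrite phiC.
Qed.

(** [u] is the sum of [s0] and the members of the list; [s0] starts the sum because [S] may lack a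
    neutral element. *)
Lemma finite_common_multiple (l : seq S) (s0 : S) :
  exists u, forall t, t \in l -> exists v, forall x, phi u x = phi v (phi t x).
Proof.
elim: l => [|t l [u ul]]; first by exists s0.
exists (t + u) => t'; rewrite inE => /orP[/eqP ->|/ul[v vE]].
  by exists u => x; rewrite -phiD phiC.
by exists (t + v) => x; rewrite -!phiD vE.
Qed.

(** Finitely many preimages of [U] cover the space. With [u] a common multiple of their indices,
    write [x] as [phi u z] and factor [phi u] through a [phi t] that brings [z] into [U]. *)
Lemma phi_cover (U : set X) : open U -> U !=set0 ->
  forall x, exists u, exists2 y, U y & phi u y = x.
Proof.
move=> oU [y Uy] x.
have [s0 _] := phi_dense x (open_nbhs_nbhs (conj oU Uy)).
have [|z|l lP] := compact_seq_cover (f := fun s => phi s @^-1` U) cX.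
- by move=> s; apply: open_comp => // z _; exact: phi_continuous.
- exact: phi_dense (open_nbhs_nbhs (conj oU Uy)).
have [u uD] := finite_common_multiple l s0.
have [z zx] := phi_surj u x.
have [t tD Ut] := lP z; have [v vE] := uD t tD.
by exists v, (phi t z) => //; rewrite -vE.
Qed.

(** * Acting maps in the coordinate of a chart *)

Section Chart.
Context (U : set X) (e : R -> X) (k : X -> R).
Hypothesis Ue : chart U e k.

Lemma chart_nbhs x a b : U x -> a < k x < b ->
  nbhs x [set y | U y /\ a < k y < b].
Proof.
move=> Ux /andP[ax xb]; apply: filterI.
  exact: open_nbhs_nbhs (conj (chart_open Ue) Ux).
have ck := chartV_continuous Ue Ux.
have : nbhs (k x) [set r | a < r < b].
  near=> r; apply/andP; split; near: r; [exact: lt_nbhsr|exact: lt_nbhsl].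
by move=> /ck.
Unshelve. all: by end_near.
Qed.

Lemma orbit_chart a b x : 0 <= a -> a < b -> b <= 1 ->
  exists s, U (phi s x) /\ a < k (phi s x) < b.
Proof.
move=> a0 ab b1; pose m := (a + b) / 2.
have m01 : 0 < m < 1 by rewrite /m; apply/andP; split; lra.
have := @chart_nbhs (e m) a b (chart_mem Ue m01).
rewrite (chartVK Ue m01) => /(_ _)/(phi_dense x); apply.
by rewrite /m; apply/andP; split; lra.
Qed.

Lemma chart_phi_continuous s t : 0 < t < 1 -> U (phi s (e t)) ->
  {for t, continuous (fun t => k (phi s (e t)))}.
Proof.
move=> t01 Ut; apply: (@continuous_comp _ _ _ e (fun x => k (phi s x))).
  exact: (chart_continuous Ue t01).
apply: continuous_comp; first exact: phi_continuous.
exact: (chartV_continuous Ue Ut).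
Qed.

Lemma chart_phi_near s t (V : set X) : 0 < t < 1 -> nbhs (phi s (e t)) V ->
  \forall u \near t, V (phi s (e u)).
Proof.
by move=> t01 /nbhs_phi Vt; exact: (chart_continuous Ue t01 Vt).
Qed.

Lemma chart_phi_near_itv s t a b : 0 < t < 1 -> U (phi s (e t)) ->
  a < k (phi s (e t)) < b ->
  \forall u \near t, U (phi s (e u)) /\ a < k (phi s (e u)) < b.
Proof. by move=> t01 Ut kt; exact: (chart_phi_near t01 (chart_nbhs Ut kt)). Qed.

Lemma chart_phi_eq s r t : U (phi s (e t)) -> U (phi r (e t)) ->
  k (phi s (e t)) = k (phi r (e t)) -> phi s = phi r.
Proof.
move=> Us Ur kE; apply: (@phi_eq _ _ (e t)).
by rewrite -(chartK Ue Us) kE (chartK Ue Ur).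
Qed.

Lemma chart_segment_closed a b : 0 < a -> b < 1 ->
  closed (e @` [set t | a <= t <= b]).
Proof.
move=> a0 b1; apply: compact_closed => //; apply: continuous_compact.
  apply: continuous_in_subspaceT => t /set_mem /= /andP[at_ tb].
  by apply: (chart_continuous Ue); apply/andP; split; lra.
have -> : [set t | a <= t <= b] = `[a, b]%classic.
  by apply/seteqP; split=> t /=; rewrite in_itv.
exact: segment_compact.
Qed.

(** A form of equicontinuity: an acting map that moves one point near [e t0] very little moves all
    nearby points little, because its graph is enclosed between those of two acting maps close to
    the identity. *)
Lemma phi_between t0 (V : set X) : 0 < t0 < 1 -> nbhs (e t0) V ->
  exists d, [/\ 0 < d, 0 < t0 - d, t0 + d < 1 &
    forall t1, t0 - d < t1 < t0 + d -> exists2 O, nbhs (e t1) O &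
    forall s, O (phi s (e t1)) ->
    forall t, t0 - d < t < t0 + d -> V (phi s (e t))].
Proof.
move=> t01 Vt0.
have [eps [eps0 l0 r1 Veps]] : exists eps, [/\ 0 < eps, 0 < t0 - eps,
    t0 + eps < 1 & forall t, t0 - eps < t < t0 + eps -> V (e t)].
  have /nbhs_ballP[r /= r0 rV] := chart_continuous Ue t01 Vt0.
  pose m := Num.min r (Num.min (t0 / 2) ((1 - t0) / 2)).
  have m0 : 0 < m by rewrite /m !lt_min r0; case/andP: t01 => *; apply/andP;
    split; lra.
  have [mr mt mt'] : [/\ m <= r, m <= t0 / 2 & m <= (1 - t0) / 2].
    by rewrite /m !ge_min !lexx !orbT.
  exists m; split; [by []|lra|lra|].
  move=> t /andP[tl tr]; apply: (rV t).
  by rewrite /ball /= ltr_norml; apply/andP; split; lra.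
(* [rp] moves [e t0] to the right and [rm] moves it to the left, both by less than [eps]. *)
have [rp [Urp /andP[rp1 rp2]]] :=
  @orbit_chart t0 (t0 + eps) (e t0) ltac:(lra) ltac:(lra) ltac:(lra).
have [rm [Urm /andP[rm1 rm2]]] :=
  @orbit_chart (t0 - eps) t0 (e t0) ltac:(lra) ltac:(lra) ltac:(lra).
pose ap t := k (phi rp (e t)); pose am t := k (phi rm (e t)).
have : \forall t \near t0, [/\ U (phi rp (e t)), U (phi rm (e t)),
    t0 - eps < am t < t & t < ap t < t0 + eps].
  pose mp := (t0 + ap t0) / 2; pose mm := (am t0 + t0) / 2.
  have Np := @chart_phi_near_itv rp t0 mp (t0 + eps) t01 Urp
    ltac:(rewrite /mp /ap; lra).
  have Nm := @chart_phi_near_itv rm t0 (t0 - eps) mm t01 Urm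
    ltac:(rewrite /mm /am; lra).
  near=> t.
  have [Up /andP[p1 p2]] : U (phi rp (e t)) /\ mp < ap t < t0 + eps by near: t.
  have [Um /andP[m1 m2]] : U (phi rm (e t)) /\ t0 - eps < am t < mm by near: t.
  have tmp : t < mp by near: t; apply: lt_nbhsl; rewrite /mp /ap; lra.
  have tmm : mm < t by near: t; apply: lt_nbhsr; rewrite /mm /am; lra.
  by split=> //; apply/andP; split; lra.
move=> /nbhs_ballP[d' /= d'0 d'P].
pose d := Num.min d' eps.
have [d0 dd' de] : [/\ 0 < d, d <= d' & d <= eps].
  by rewrite /d lt_min d'0 eps0 !ge_min !lexx orbT.
have dP t : t0 - d < t < t0 + d -> [/\ 0 < t < 1, U (phi rp (e t)),
    U (phi rm (e t)), t0 - eps < am t < t & t < ap t < t0 + eps].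
  move=> /andP[tl tr]; have [|? ? ? ?] := d'P t.
    by rewrite /ball /= ltr_norml; apply/andP; split; lra.
  by split=> //; apply/andP; split; lra.
exists d; split; [by []|lra|lra|] => t1 t1d.
have [t101 Up1 Um1 am1 ap1] := dP t1 t1d.
(* This neighbourhood asks that the graph be enclosed at the single point [t1]. *)
exists [set y | U y /\ am t1 < k y < ap t1].
  apply: chart_nbhs; first exact: (chart_mem Ue).
  by rewrite (chartVK Ue) //; apply/andP; split; lra.
move=> s /= Ps1.
pose P t := U (phi s (e t)) /\ am t < k (phi s (e t)) < ap t.
(* [P] is open and closed in the interval: at a limit point [phi s (e t)] is in
   the compact arc around [e t0], and it differs from both [phi rm (e t)] and
   [phi rp (e t)] because these maps agree nowhere. *)
suff PP t : t0 - d < t < t0 + d -> P t.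
  move=> t td; have [Us kt] := PP t td.
  have [_ _ _ at_ pt] := dP t td.
  by rewrite -(chartK Ue Us); apply: Veps; apply/andP; split; lra.
move=> td; apply: (interval_locally_constant _ t1d td Ps1) => {t td} x xd.
have [x01 Up Um amx apx] := dP x xd.
have nearx : \forall y \near x, t0 - d < y < t0 + d.
  near=> y; apply/andP; split; near: y; [apply: lt_nbhsr|apply: lt_nbhsl]; lra.
have away : (\forall y \near x, ~ P y) -> ~ P x -> \forall y \near x, P y <-> P
  x.
  by move=> nP Px; apply: filterS nP => y Py.
have [Ux|nUx] := pselect (U (phi s (e x))); last first.
  apply: away; last by case.
  pose K := e @` [set t | t0 - eps <= t <= t0 + eps].
  have nK : nbhs (phi s (e x)) (~` K).
    apply: open_nbhs_nbhs; split.
      by apply: closed_openC; exact: chart_segment_closed.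
    move=> [t /= te ex]; apply: nUx; rewrite -ex; apply: (chart_mem Ue).
    by apply/andP; split; lra.
  have nKx := chart_phi_near x01 nK.
  apply: filterS2 nearx nKx => y yd; apply: contra_not => -[Uy kty].
  have [_ _ _ amy apy] := dP y yd.
  by exists (k (phi s (e y))); [rewrite /=; lra|exact: (chartK Ue)].
have nsp : k (phi s (e x)) != ap x.
  apply/eqP => /(chart_phi_eq Ux Up) E; case: Ps1 => _.
  by rewrite E ltxx andbF.
have nsm : k (phi s (e x)) != am x.
  apply/eqP => /(chart_phi_eq Ux Um) E; case: Ps1 => _.
  by rewrite E ltxx.
have nears a b := @chart_phi_near_itv s x a b x01 Ux.
have nearp a b := @chart_phi_near_itv rp x a b x01 Up.
have nearm a b := @chart_phi_near_itv rm x a b x01 Um.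
set ks := k (phi s (e x)) in nsp nsm nears.
pose mm := (am x + ks) / 2; pose mp := (ap x + ks) / 2.
have [ltm|gtm|] := ltgtP ks (am x); last by move/eqP; rewrite (negPf nsm).
- apply: away; last by rewrite /P -/ks; lra.
  have N1 := nears (ks - 1) mm ltac:(rewrite /mm; lra).
  have N2 := nearm mm (am x + 1) ltac:(rewrite /mm -/(am x); lra).
  by apply: filterS2 N1 N2 => y [_ ?] [_ ?]; rewrite /P /am; lra.
have [ltp|gtp|] := ltgtP ks (ap x); last by move/eqP; rewrite (negPf nsp).
- have N1 := nears mm mp ltac:(rewrite /mm /mp; lra).
  have N2 := nearm (am x - 1) mm ltac:(rewrite /mm -/(am x); lra).
  have N3 := nearp mp (ap x + 1) ltac:(rewrite /mp -/(ap x); lra).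
  have Px : P x by split=> //; rewrite -/ks; lra.
  apply: filterS3 N1 N2 N3 => y [Uy ?] [_ ?] [_ ?].
  by split=> // _; split=> //; rewrite /am /ap; lra.
- apply: away; last by rewrite /P -/ks; lra.
  have N1 := nears mp (ks + 1) ltac:(rewrite /mp; lra).
  have N2 := nearp (ap x - 1) mp ltac:(rewrite /mp -/(ap x); lra).
  by apply: filterS2 N1 N2 => y [_ ?] [_ ?]; rewrite /P /ap; lra.
Unshelve. all: by end_near.
Qed.

(** * Maps close to the identity, and injectivity *)

Lemma chart_nonempty : U !=set0.
Proof. by exists (e (1 / 2)); apply: (chart_mem Ue); lra. Qed.

(** Write [x] as [phi u y] with [y] in the chart and let [phi a] bring [p] near [y]. If [phi s]
    hardly moves [p], then by commutativity it hardly moves [phi a p], hence by [phi_between]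
    neither [y], and so neither [x]. *)
Lemma phi_close_to_id p x (V : set X) : nbhs x V ->
  exists2 O, nbhs p O & forall s, O (phi s p) -> V (phi s x).
Proof.
move=> Vx; have [u [y Uy yx]] := phi_cover (chart_open Ue) chart_nonempty x.
have ky := chart_itv Ue Uy; have yk := chartK Ue Uy.
have Vy : nbhs (e (k y)) (phi u @^-1` V) by rewrite yk; apply: nbhs_phi;
  rewrite yx.
have [d [d0 kd0 kd1 sandwich]] := phi_between ky Vy.
have [a [Ua kad]] := @orbit_chart (k y - d) (k y + d) p (ltW kd0) ltac:(lra)
  (ltW kd1).
have [W Oa OV] := sandwich _ kad.
exists (phi a @^-1` W).
  by apply: nbhs_phi; rewrite -(chartK Ue Ua).
move=> s /= Os; rewrite -yx phiC -yk; apply: OV; last lra.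
by rewrite (chartK Ue Ua) phiC.
Qed.

(** Choose [s] so that [phi s] brings [phi r x] back close to [x]. Then [phi (s + r)] is close to
    the identity at both [x] and [y], so a common image would be near both. *)
Lemma phi_inj r : injective (phi r).
Proof.
move=> x y rxy; apply: hX => A B Ax By.
have [W Ox OA] := phi_close_to_id x Ax;
  have [W' Ox' OB] := phi_close_to_id x By.
have [s [Os Os']] := phi_dense (phi r x) (filterI Ox Ox').
move: Os Os'; rewrite phiD => Os Os'.
exists (phi (s + r) x); split; first exact: OA.
by rewrite -phiD rxy phiD; exact: OB.
Qed.

Lemma phi_homeomorphism s : homeomorphism (phi s).
Proof.
apply: compact_bij_homeomorphism => //; [exact: phi_inj|exact: phi_surj].
Qed.

(** A cluster point of the iterates of [p] is moved into the arc by some [phi u], so the iterates of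
    [phi u p] visit the arc infinitely often; two visits at least 2 steps apart give the return. *)
Lemma orbit_recurrent (p : X) c d : 0 < c -> c < d -> d < 1 -> forall s,
  exists t n, [/\ c <= t <= d, (2 <= n)%N, U (iter n (phi s) (e t)) &
    c <= k (iter n (phi s) (e t)) <= d].
Proof.
move=> c0 cd d1 s; have cs x n u :
  iter n (phi s) (phi u x) = phi u (iter n (phi s) x).
  by elim: n => //= n ->; rewrite phiC.
have [x [_ clx]] :=
  cX (fmap_proper_filter (fun n => iter n (phi s) p) eventually_filter) filterT.
have [u [Uu ku]] := @orbit_chart c d x (ltW c0) cd (ltW d1).
have Nx := nbhs_phi (chart_nbhs Uu ku).
have hit m : exists2 n, (m <= n)%N & let y := iter n (phi s) (phi u p) in
    U y /\ c < k y < d.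
  have [_ [[n /= mn <-] Hn]] :
    ([set iter n (phi s) p | n in [set n | (m <= n)%N]]
      `&` phi u @^-1` [set y | U y /\ c < k y < d]) !=set0.
    by apply: clx => //; exists m => // n /= mn; exists n.
  by exists n; rewrite //= cs.
have [m _ [Um km]] := hit 0%N; have [n mn [Un kn]] := hit (m + 2)%N.
exists (k (iter m (phi s) (phi u p))), (n - m)%N; rewrite (chartK Ue Um) -iterD.
have -> : (n - m + m = n)%N by rewrite subnK // (leq_trans _ mn) ?leq_addr.
split=> //; [lra| |lra].
by rewrite leq_subRL ?(leq_trans _ mn) ?leq_addr.
Qed.

Lemma small_translation c : 0 < c < 1 -> exists s d, [/\ c < d, d < 1,
  phi s (e c) = e d, forall t, c <= t <= d -> U (phi s (e t)) &
  forall t, c < t <= d -> d < k (phi s (e t))].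
Proof.
move=> c01.
have Uc := open_nbhs_nbhs (conj (chart_open Ue) (chart_mem Ue c01)).
have [r [r0 cr0 cr1 sandwich]] := phi_between c01 Uc.
(* A map that sends [e c] into [W] keeps the arc around [c] in the chart. So [s] is chosen to send
   [e c] close to [e (c + q)], inside [W] and to the right of [c]. *)
have [W Oc OU] := sandwich c ltac:(lra).
have [q [q0 qr Oq]] : exists q, [/\ 0 < q, q < r & W^° (e (c + q))].
  have /(chart_continuous Ue c01)/nbhs_ballP[q' /= q'0 Oq'] : nbhs (e c) W^°.
    exact: nbhs_interior.
  pose q := Num.min q' r / 2.
  have [qq' qr q0] : [/\ q < q', q < r & 0 < q].
    have : 0 < Num.min q' r by rewrite lt_min q'0 r0.
    have : Num.min q' r <= q' by rewrite ge_min lexx.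
    have : Num.min q' r <= r by rewrite ge_min lexx orbT.
    by rewrite /q => ? ? ?; split; lra.
  exists q; split=> //; apply: Oq'.
  by rewrite /ball /= ltr_norml; apply/andP; split; lra.
have cq01 : 0 < c + q < 1 by lra.
have NO := open_nbhs_nbhs (conj (@open_interior _ W) Oq).
have Ncr := @chart_nbhs (e (c + q)) c (c + r) (chart_mem Ue cq01)
  ltac:(rewrite (chartVK Ue cq01); lra).
have [s [/interior_subset Os [Us ks]]] := phi_dense (e c) (filterI NO Ncr).
pose g t := k (phi s (e t)); have [d gc] : exists d, g c = d by exists (g c).
have [cd dcr] : c < d /\ d < c + r by rewrite -gc /g; split; lra.
have Ut t : c <= t <= d -> U (phi s (e t)) by move=> ctd; apply: OU => //; lra.
have t01 t : c <= t <= d -> 0 < t < 1 by lra.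
have cg t : c <= t <= d -> {for t, continuous g}.
  by move=> ctd; apply: chart_phi_continuous; [exact: t01|exact: Ut].
have gI t : c <= t <= d -> e (g t) = phi s (e t).
  by move=> /Ut; exact: (chartK Ue).
have cc : c <= c <= d by lra.
have dd : c <= d <= d by lra.
have gfix t : c <= t <= d -> g t != t.
  move=> ctd; apply/eqP => gt.
  have sid : phi s = id by apply: (@phi_fixed _ (e t)); rewrite -gI // gt.
  by move: cd; rewrite -gc /g sid (chartVK Ue c01) ltxx.
(* A fixed point would make [phi s] the identity, so [g t - t] keeps the sign it has at [c]. *)
have gd : d < g d.
  rewrite ltNge; apply/negP => gdd.
  have [t ctd||t ctd ht] := @image_IVT _ (fun t => g t - t) c d 0 (ltW cd).
  - by apply: continuousB; [exact: cg|exact: cvg_id].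
  - by right; rewrite gc; lra.
  - by move: (gfix t ctd); rewrite -subr_eq0 ht eqxx.
exists s, d; split; [by []|lra|by rewrite -gc gI|exact: Ut|].
have ginj t : c < t <= d -> g t != d.
  move=> ctd; apply/eqP => gt; have ctd' : c <= t <= d by lra.
  have /phi_inj/(congr1 k) : phi s (e t) = phi s (e c) by rewrite -!gI // gt gc.
  by rewrite !(chartVK Ue) //; [lra|exact: t01].
(* Only [c] goes to [d], so [g] cannot be below [d] at a later point of the arc and then climb to
   [g d]. *)
move=> t ctd; rewrite -/(g t) ltNge le_eqVlt negb_or ginj //=.
apply/negP => gtd.
have [u tud||u tud gu] := @image_IVT _ g t d d ltac:(lra).
- by apply: cg; lra.
- by left; lra.
- by have := ginj u ltac:(lra); rewrite gu eqxx.
Qed.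

(** * Embedded circles in the space *)

Local Notation circ := (set_type (circle R)).

(** Some [phi s] moves [p t] into the chart, where invariance of domain applies to the coordinate of
    the path; injectivity of [phi s] brings the neighbourhood back. *)
Lemma path_image_nbhs (p : R -> X) (a b t : R) : a < t < b -> continuous p ->
  (forall u v, a < u < b -> a < v < b -> p u = p v -> u = v) ->
  nbhs (p t) (p @` [set u | a < u < b]).
Proof.
move=> /andP[at_ tb] cp injp.
have [s [Us _]] := orbit_chart (p t) (lexx 0) ltr01 (lexx 1).
have cq : continuous (phi s \o p).
  by move=> u; apply: continuous_comp; [exact: cp|exact: phi_continuous].
have NU : nbhs (phi s (p t)) U by exact:
  open_nbhs_nbhs (conj (chart_open Ue) Us).
have /nbhs_ballP[r /= r0 rU] : nbhs t ((phi s \o p) @^-1` U) := cq t _ NU.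
pose a' := Num.max a (t - r); pose b' := Num.min b (t + r).
have [aa' ra' at' [tb' bb' rb']] :
    [/\ a <= a', t - r <= a', a' < t & [/\ t < b', b' <= b & b' <= t + r]].
  rewrite /a' /b' !le_max !ge_min !lexx !orbT gt_max lt_min at_ tb /=.
  by split=> //; [lra|split=> //; lra].
pose f u := k (phi s (p u)).
have Uf u : a' < u < b' -> U (phi s (p u)).
  by move=> ?; apply: rU; rewrite /ball /= ltr_norml; lra.
have Nf : nbhs (f t) (f @` [set u | a' < u < b']).
  apply: continuous_inj_image_nbhs; first lra.
    move=> u /Uf Uu; apply: (@continuous_comp _ _ _ (phi s \o p) k).
      exact: cq.
    exact: (chartV_continuous Ue Uu).
  move=> u v uI vI fuv; apply: injp; [lra|lra|].
  apply: (phi_inj (r := s)).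
  by rewrite -(chartK Ue (Uf u uI)) -(chartK Ue (Uf v vI)) -/(f u) fuv.
have Nk : nbhs (phi s (p t)) (k @^-1` (f @` [set u | a' < u < b'])).
  exact: (chartV_continuous Ue Us Nf).
have NI := nbhs_phi (@filterI _ _ (nbhs_filter _) _ _ NU Nk).
apply: filterS NI => x /= [Ux [u uI fu]]; exists u; first by rewrite /=; lra.
apply: (phi_inj (r := s)).
by rewrite -(chartK Ue (Uf u uI)) -/(f u) fu (chartK Ue Ux).
Qed.

Lemma circle_image_open (f : circ -> X) :
  continuous f -> injective f -> open (range f).
Proof.
move=> cf injf; rewrite openE => _ [z _ <-]; rewrite /interior.
have [t _ <-] := circle_point_surj z; have p0 := pi_gt0 R.
(* [circle_point] is injective on this open interval of length [2 pi]. *)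
have Ht : t - pi < t < t + pi by lra.
have cft : continuous (f \o @circle_point R).
  by move=> u; apply: continuous_comp;
    [exact: circle_point_continuous|exact: cf].
apply: filterS (path_image_nbhs Ht cft _) => [_ [u _ <-]|u v uI vI];
  first by exists (circle_point u).
by move=> /injf/circle_point_inj; apply; rewrite mulr2n ltr_norml; lra.
Qed.

Lemma exists_circle (x0 : X) : exists f :
  circ -> X, continuous f /\ injective f.
Proof.
have [c c01] : exists c : R, 0 < c < 1 by exists (1 / 2); lra.
have [s [d [cd d1 sc Us ks]]] := small_translation c01.
have c0 : 0 < c by case/andP: c01.
have [r [n [rcd n2 Ur kr]]] := orbit_recurrent x0 c0 cd d1 s.
have I01 t : c <= t <= d -> 0 < t < 1 by lra.
(* Clamping the parameter to [[0, 1]] makes [arc] continuous on the whole line. *)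
pose arc t := e (c + (d - c) * Num.max 0 (Num.min t 1)).
have arcE t : 0 <= t <= 1 -> arc t = e (c + (d - c) * t).
  by move=> /andP[t0 t1]; rewrite /arc min_l // max_r.
have param t : 0 <= t <= 1 -> c <= c + (d - c) * t <= d by nra.
have param_inv u : c <= u <= d -> exists2 t, 0 <= t <= 1 & c + (d - c) * t = u.
  move=> ucd; exists ((u - c) / (d - c)); last by field; lra.
  by rewrite ler_pdivlMr ?ler_pdivrMr; lra.
have arcAE : arc @` [set t : R | 0 <= t <= 1] = e @` [set u : R | c <= u <= d].
  apply/seteqP; split=> [_ [t /= t01 <-]|_ [u /= /param_inv[t t01 <-] <-]].
    by exists (c + (d - c) * t); [exact: param|rewrite arcE].
  by exists t => //; rewrite arcE.
have carc : continuous arc.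
  move=> t; apply: (@continuous_comp _ _ _ (fun t :
    R => c + (d - c) * Num.max 0 (Num.min t 1))).
    apply: continuousD; first exact: cvg_cst.
    apply: continuousM; first exact: cvg_cst.
    apply: continuous_max; first exact: cvg_cst.
    by apply: continuous_min; [exact: cvg_id|exact: cvg_cst].
  apply: (chart_continuous Ue); apply: I01; apply: param.
  by rewrite le_max lexx /= ge_max ler01 ge_min lexx orbT.
have arc1 : arc 1 = phi s (arc 0).
  by rewrite !arcE ?lexx ?ler01 // mulr1 mulr0 addr0 sc; congr e; ring.
have [||||||tau tau0 [tauE tau_inj]] :=
  @first_return R X (phi s) arc (@phi_continuous s) (phi_inj (r := s)) carc.
- move=> t u t01 u01; rewrite !arcE // => /(congr1 k).
  rewrite !(chartVK Ue) ?I01 ?param // => E.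
  have : (d - c) * (t - u) = 0 by lra.
  by move/eqP; rewrite mulf_eq0 !subr_eq0 gt_eqF //= => /eqP.
- exact: arc1.
- by rewrite arcAE; exact: chart_segment_closed.
- move=> t t01; rewrite arcAE arcE; last lra.
  have ucd : c < c + (d - c) * t < d by nra.
  have ucd' : 0 < c + (d - c) * t < 1 by lra.
  have NU := @chart_nbhs (e (c + (d - c) * t)) c d (chart_mem Ue ucd').
  rewrite (chartVK Ue ucd') in NU; apply: filterS (NU ucd) => y [Uy ky].
  by exists (k y); [rewrite /=; lra|exact: (chartK Ue)].
- move=> t t01; rewrite arcAE arcE; last lra.
  move=> [u /= ucd /(congr1 k)]; rewrite (chartVK Ue (I01 _ ucd)) => uE.
  by have := ks (c + (d - c) * t); rewrite -uE; nra.
- have [t t01 tE] := param_inv _ rcd; exists t, n; split=> //.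
  rewrite arcE // tE arcAE; exists (k (iter n (phi s) (e r))) => //;
    exact: (chartK Ue Ur).
apply: (loop_circle _ tau0 tauE tau_inj);
  exact: flow_line_continuous (@phi_continuous s) carc arc1.
Qed.

Lemma finite_union_circles (x0 : X) : finite_union_of_circles R X.
Proof.
have [f [cf injf]] := exists_circle x0.
have of_ := circle_image_open cf injf.
(* Every orbit enters the open circle, so its preimages cover the space and finitely many suffice;
   each is again a circle since [phi s] is a homeomorphism. *)
have [|x|l lP] := compact_seq_cover (f := fun s => phi s @^-1` range f) cX.
- by move=> s; apply: open_comp => // x _; exact: phi_continuous.
- apply: (phi_dense x (y := f (circle_point 0))).
  by apply: open_nbhs_nbhs; split=> //; exists (circle_point 0).
have hom s : exists h : circ -> X, [/\ continuous h, injective h &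
    range h = phi s @^-1` range f].
  have [cs [psi [cpsi psiK Kpsi]]] := phi_homeomorphism s.
  exists (psi \o f); split.
  - by move=> z; apply: continuous_comp; [exact: cf|exact: cpsi].
  - by move=> z w /(can_inj Kpsi)/injf.
  - apply/seteqP; split=> [_ [z _ <-]|x [z _ zx]] /=; first by exists z;
    rewrite ?Kpsi.
    by exists z => //=; rewrite zx psiK.
pose h s := projT1 (cid (hom s)).
have hP s : [/\ continuous (h s), injective (h s) & range (h s) = phi s @^-1`
  range f].
  by rewrite /h; case: cid.
apply: (@sum_of_circles _ _ x0 (map h l)) =>
  // [g /List.in_map_iff[s [<- _]]|x].
  have [ch ih _] := hP s; split=> //; exact: circle_image_open.
have [s sl fx] := lP x; exists (h s); last by have [_ _ ->] := hP s.
by apply: List.in_map; elim: l sl {lP} => //= a l IH;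
  rewrite inE => /orP[/eqP->|/IH]; [left|right].
Qed.
End Chart.
End MinimalAction.

(** * Passage from the joint action to its acting maps *)

Theorem theoremA (R : realType) (X : topologicalType) (S : addSemigroupType)
    (Phi : discrete_topology S * X -> X)
    (Xcompact : compact [set: X])
    (Xhausdorff : hausdorff_space X)
    (Xfree : exists U : set X, free_interval R U)
    (Snonempty : [set: S] !=set0)
    (PhiA : semigroup_action Phi)
    (Phimin : minimal_action Phi) :
  finite_union_of_circles R X /\
  forall s : S, homeomorphism (acting_map Phi s).
Proof.
have [U Ufree] := Xfree; have [e [k Ue]] := free_interval_chart Ufree.
have [x0 _] := chart_nonempty Ue; have [cPhi PhiD] := PhiA.
have cphi s : continuous (acting_map Phi s).
  move=> x; apply: (@continuous_comp _ _ _ (fun x => (s :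
    discrete_topology S, x))).
    exact: (cvg_pair (cvg_cst _) cvg_id).
  exact: cPhi.
have dphi (x y : X) (V : set X) : nbhs y V -> exists s, V (acting_map Phi s x).
  rewrite nbhsE => -[W [oW Wy] WV].
  have [|_ [/[swap] [[s _ <-]] Ws]] := Phimin x W _ oW; first by exists y.
  by exists s; exact: WV.
split; first exact: (finite_union_circles Xcompact Xhausdorff cphi PhiD dphi Ue
  x0).
by move=> s; exact: (phi_homeomorphism Xcompact Xhausdorff cphi PhiD dphi Ue).
Qed.
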